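(* Let $n$ be a positive integer, let $T$ be a finitely generated subsemigroup of $UT_n(\mathbb{R}_{\max})$, and let $t$ be the rank of the free abelian subgroup of $(\mathbb{R},+)$ generated as a group by the finite entries of the matrices in $T$. Then the growth function of $T$ is bounded above by a polynomial of degree $\frac{tn(n+1)}{2}$.
   Context: $\mathbb{N}$ is the set of positive integers. $\mathbb{R}_{\max}=\mathbb{R}\cup\{-\infty\}$ is the tropical semiring, with semiring addition $\max$ and semiring multiplication the usual addition (zero $-\infty$, one $0$). $UT_n(\mathbb{R}_{\max})$ is the monoid, under (tropical) matrix multiplication, of all $n\times n$ matrices over $\mathbb{R}_{\max}$ with all entries below the diagonal equal to $-\infty$. A finite entry is an entry different from $-\infty$. For a semigroup generated by a finite set $X$, its growth function with respect to $X$ is $f_X(k) = |\bigcup_{i=1}^k X^i|$ for $k\in\mathbb{N}$, where $X^i$ is the set of products of $i$ elements of $X$. It is bounded above by a polynomial of degree $m$ if there is $c_X>0$ such that $f_X(k)\le c_Xk^m$ for all $k\in\mathbb{N}$. This property does not depend on the choice of finite generating set, so one says that the growth function of the semigroup is bounded above by a polynomial of degree $m$ without reference to a generating set. *)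

(* Defs.v *)
From HB Require Import structures.
From mathcomp Require Import all_boot all_order all_algebra.
From mathcomp Require Import finmap boolp classical_sets functions cardinality reals.

Set Implicit Arguments.
Unset Strict Implicit.
Unset Printing Implicit Defensive.

Import Order.TTheory GRing.Theory Num.Theory.
Local Open Scope classical_set_scope.
Local Open Scope ring_scope.

(* [None] is the element -oo and [Some x] the finite element x. With the      *)
(* semiring structure below, [+], [*], [0] and [1] on [Rmax R] are max, the   *)
(* usual addition, -oo and the real number 0; in particular the product of    *)
(* the library on ['M[Rmax R]_n] is the tropical matrix product.              *)
Definition Rmax (R : realType) : Type := option R.

HB.instance Definition _ (R : realType) := Choice.on (Rmax R).

Section RmaxSemiring.
Variable R : realType.
Implicit Types a b c : Rmax R.

Definition rmax_add a b : Rmax R :=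
  match a, b with
  | Some x, Some y => Some (Num.max x y)
  | Some x, None => Some x
  | None, _ => b
  end.

Definition rmax_mul a b : Rmax R :=
  match a, b with
  | Some x, Some y => Some (x + y)
  | _, _ => None
  end.

Fact rmax_addA : associative rmax_add.
Proof. by move=> [x|] [y|] [z|] //=; rewrite maxA. Qed.

Fact rmax_addC : commutative rmax_add.
Proof. by move=> [x|] [y|] //=; rewrite maxC. Qed.

Fact rmax_add0 : left_id None rmax_add.
Proof. by []. Qed.

HB.instance Definition _ :=
  GRing.isNmodule.Build (Rmax R) rmax_addA rmax_addC rmax_add0.

Fact rmax_mulA : associative rmax_mul.
Proof. by move=> [x|] [y|] [z|] //=; rewrite addrA. Qed.

Fact rmax_mulC : commutative rmax_mul.
Proof. by move=> [x|] [y|] //=; rewrite addrC. Qed.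

Fact rmax_mul1 : left_id (Some 0) rmax_mul.
Proof. by move=> [x|] //=; rewrite add0r. Qed.

Fact rmax_mulDl : left_distributive rmax_mul rmax_add.
Proof. by move=> [x|] [y|] [z|] //=; rewrite addr_maxl. Qed.

Fact rmax_mul0 : left_zero None rmax_mul.
Proof. by []. Qed.

Fact rmax_one_neq0 : Some 0 != 0 :> Rmax R.
Proof. by []. Qed.

HB.instance Definition _ :=
  GRing.Nmodule_isComNzSemiRing.Build (Rmax R)
    rmax_mulA rmax_mulC rmax_mul1 rmax_mulDl rmax_mul0 rmax_one_neq0.

End RmaxSemiring.

(* The semigroups considered are multiplicative subsemigroups of a semiring.  *)
Section Growth.
Variable S : pzSemiRingType.
Implicit Types X T : set S.

Definition subsemigroup T := forall x y, T x -> T y -> T (x * y).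

Definition generated_semigroup X : set S := smallest subsemigroup X.

Definition fin_gen_semigroup T :=
  exists2 X : set S, finite_set X & T = generated_semigroup X.

Definition products X (i : nat) : set S :=
  [set \prod_(j < i) w j | w in [set w : 'I_i -> S | forall j, X (w j)]].

(* [fset_set] is only meaningful on finite sets; the union below is finite    *)
(* whenever X is.                                                             *)
Definition growth_function X (k : nat) : nat :=
  #|` fset_set (\bigcup_(i in [set i | (1 <= i <= k)%N]) products X i) |%fset.

Definition growth_bounded_by_degree (R : realType) T (m : nat) :=
  forall X : set S, finite_set X -> T = generated_semigroup X ->
  exists2 c : R, 0 < c &
    forall k : nat, (1 <= k)%N ->
      (growth_function X k)%:R <= c * k%:R ^+ m.

End Growth.

Section FreeRank.
Variable V : zmodType.
Implicit Types (G E : set V) (t : nat).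

Definition subgroup G := G 0 /\ forall x y, G x -> G y -> G (x - y).

Definition generated_subgroup E : set V := smallest subgroup E.

Definition Zbasis t (b : 'I_t -> V) G :=
  (forall x, G x <-> exists c : 'I_t -> int, x = \sum_i b i *~ c i) /\
  (forall c : 'I_t -> int, \sum_i b i *~ c i = 0 -> forall i, c i = 0).

(* The number of elements of a finite Z-basis of G, and 0 if there is none.   *)
Definition free_rank G : nat :=
  xget 0%N [set t | exists b : 'I_t -> V, Zbasis b G].

Lemma Zbasis_leq t s (b : 'I_t -> V) (b' : 'I_s -> V) G :
  Zbasis b G -> Zbasis b' G -> (t <= s)%N.
Proof.
move=> [bG b0] [b'G _].
have mem u (d : 'I_u -> V) i : exists c : 'I_u -> int, d i = \sum_j d j *~ c j.
  exists (fun j => (j == i)%:Z); rewrite (bigD1 i) //= eqxx mulr1z.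
  by rewrite big1 ?addr0 // => j /negbTE ->; rewrite mulr0z.
have /choice [P PE] i : exists c, b i = \sum_j b' j *~ c j.
  by apply/b'G/bG; exact: mem.
have /choice [Q QE] j : exists c, b' j = \sum_i b i *~ c i.
  by apply/bG/b'G; exact: mem.
pose A : 'M[int]_(t, s) := \matrix_(i, j) P i j.
pose B : 'M[int]_(s, t) := \matrix_(j, i) Q j i.
apply: (@mulmx1_min int t s A B); apply/matrixP => i k.
apply/eqP; rewrite -subr_eq0; apply/eqP.
apply: (b0 (fun k => (A *m B) i k - 1%:M i k)).
rewrite (eq_bigr (fun k => b k *~ (A *m B) i k - b k *~ 1%:M i k)); last first.
  by move=> j _; rewrite mulrzBr.
rewrite sumrB; apply/eqP; rewrite subr_eq0; apply/eqP.
transitivity (b i); last first.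
  rewrite (bigD1 i) //= mxE eqxx mulr1z big1 ?addr0 // => j ji.
  by rewrite mxE eq_sym (negbTE ji) mulr0z.
rewrite PE; under [RHS]eq_bigr => j _ do rewrite QE mulrz_suml.
rewrite exchange_big /=; apply: eq_bigr => l _.
rewrite mxE mulrz_sumr; apply: eq_bigr => j _.
by rewrite !mxE -mulrzA mulrC.
Qed.

Lemma free_rankE t (b : 'I_t -> V) G : Zbasis b G -> free_rank G = t.
Proof.
move=> bG; apply: xget_unique; first by exists b.
move=> s [b' b'G]; apply/eqP; rewrite eqn_leq.
by rewrite (Zbasis_leq bG b'G) (Zbasis_leq b'G bG).
Qed.

End FreeRank.

Definition UT (R : realType) (n : nat) : set 'M[Rmax R]_n :=
  [set A | forall i j : 'I_n, (j < i)%N -> A i j = None].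
Arguments UT : clear implicits.

Definition finite_entries (R : realType) (n : nat) (T : set 'M[Rmax R]_n) :
    set R :=
  [set x | exists2 A, T A & exists i j, A i j = Some x].

(* Main.v *)
Require Import Defs.
From mathcomp Require Import all_boot all_order all_algebra.
From mathcomp Require Import finmap boolp classical_sets functions cardinality reals.

(** Let X be a finite generating set of T.  A finite entry of a product of i
    generators is the weight of an optimal path, hence a sum of i finite
    entries of generators.  So the subgroup G spanned by the finite entries of T
    is already spanned by those of X: it is finitely generated and, being
    torsion-free, has a basis b of t elements ([Zspan_has_basis]; without this,
    [free_rank] would be the default value 0).

    If C bounds the coordinates in b of the finite entries of X, then each
    finite entry of a product of at most k generators has coordinates in
    [-Ck, Ck] ([prod_entries_bounded]), which leaves (2Ck + 1)^t + 1 values for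
    an entry, -oo included.  As only the n(n+1)/2 entries on and above the
    diagonal vary, there are at most ((2Ck + 1)^t + 1)^(n(n+1)/2) such products
    ([card_bounded_matrices]), a quantity of order k^(t n(n+1)/2). *)

Set Implicit Arguments.
Unset Strict Implicit.
Unset Printing Implicit Defensive.

Import Order.TTheory GRing.Theory Num.Theory.
Local Open Scope classical_set_scope.
Local Open Scope ring_scope.

(** * Bases of finitely generated torsion-free abelian groups *)

Section ZSpan.
Variable V : zmodType.

Lemma subgroupN (G : set V) x : subgroup G -> G x -> G (- x).
Proof. by move=> [G0 GB] Gx; rewrite -sub0r; exact: GB. Qed.

Lemma subgroupD (G : set V) x y : subgroup G -> G x -> G y -> G (x + y).
Proof.
move=> Gsub Gx Gy; rewrite -[y]opprK.
by apply: Gsub.2 => //; exact: subgroupN.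
Qed.

Definition Zcomb m (g : 'I_m -> V) (a : 'I_m -> int) : V := \sum_i g i *~ a i.

Definition Zspan m (g : 'I_m -> V) : set V := range (Zcomb g).

Lemma Zcomb0 m (g : 'I_m -> V) : Zcomb g (fun=> 0) = 0.
Proof. by rewrite /Zcomb big1 // => i _; rewrite mulr0z. Qed.

Lemma ZcombD m (g : 'I_m -> V) a a' :
  Zcomb g (fun i => a i + a' i) = Zcomb g a + Zcomb g a'.
Proof. by rewrite /Zcomb -big_split; apply: eq_bigr => i _; rewrite mulrzDr. Qed.

Lemma ZcombB m (g : 'I_m -> V) a a' :
  Zcomb g (fun i => a i - a' i) = Zcomb g a - Zcomb g a'.
Proof. by rewrite /Zcomb -sumrB; apply: eq_bigr => i _; rewrite mulrzBr. Qed.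

Lemma Zspan_subgroup m (g : 'I_m -> V) : subgroup (Zspan g).
Proof.
split; first by exists (fun=> 0) => //; rewrite Zcomb0.
move=> _ _ [a _ <-] [a' _ <-].
by exists (fun i => a i - a' i) => //; rewrite ZcombB.
Qed.

Lemma mem_Zspan m (g : 'I_m -> V) i : Zspan g (g i).
Proof.
exists (fun j => (j == i)%:Z) => //.
rewrite /Zcomb (bigD1 i) //= eqxx mulr1z big1 ?addr0 // => j /negbTE ->.
by rewrite mulr0z.
Qed.

Lemma subgroup_Zspan m (g : 'I_m -> V) G :
  subgroup G -> (forall i, G (g i)) -> Zspan g `<=` G.
Proof.
move=> Gsub Gg _ [a _ <-]; rewrite /Zcomb.
have Gn x k : G x -> G (x *+ k).
  move=> Gx; elim: k => [|k IHk]; first exact: Gsub.1.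
  by rewrite mulrS; exact: subgroupD.
apply: (@big_ind _ G) => [|x y|i _]; first exact: Gsub.1.
  exact: subgroupD.
by case: (a i) => k; [|apply: subgroupN => //]; exact: Gn.
Qed.

Lemma Zcomb_mulmx p m (g : 'I_m -> V) (U : 'M[int]_(p, m)) (a : 'rV_p) :
  Zcomb (fun i => Zcomb g (U i)) (a ord0) = Zcomb g ((a *m U) ord0).
Proof.
rewrite /Zcomb; under eq_bigr => i _ do rewrite mulrz_suml.
rewrite exchange_big /=; apply: eq_bigr => j _.
rewrite mxE mulrz_sumr; apply: eq_bigr => i _.
by rewrite -mulrzA mulrC.
Qed.

(** The Smith normal form of a single row has at most one nonzero entry, so only
    the first row of the right-hand unimodular factor matters. *)
Lemma int_row_unimodular m (c : 'rV[int]_m.+1) :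
  exists2 U : 'M[int]_m.+1, U \in unitmx & exists d, c = d *: row ord0 U.
Proof.
have [L _ [U Uunit [d _ ->]]] := int_Smith_normal_form c.
exists U => //; exists (L ord0 ord0 * d`_0).
apply/rowP => j; rewrite !mxE (bigD1 ord0) //= big1 ?addr0 => [|i i_neq0].
  by rewrite !mxE big_ord1 mxE eqxx mulr1n.
rewrite !mxE big_ord1 mxE eq_sym.
by move: i_neq0; rewrite -val_eqE /= => /negbTE ->; rewrite mulr0 mul0r.
Qed.

(** A nontrivial relation between m generators is, after a unimodular change of
    generators, a multiple of the first one; the latter vanishes for want of
    torsion, so m - 1 generators suffice. *)
Lemma Zspan_has_basis m (g : 'I_m -> V) :
  (forall (x : V) (d : int), x *~ d = 0 -> d = 0 \/ x = 0) ->
  exists t (b : 'I_t -> V), Zbasis b (Zspan g).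
Proof.
move=> tf; elim: m g => [|m IHm] g.
  exists 0%N, g; split; last by move=> c _ [].
  by move=> x; split=> [[a _ <-]|[a ->]]; exists a.
have [free_g|/existsNP[c /not_implyP[c_rel /existsNP[k ck]]]] :=
    pselect (forall c, Zcomb g c = 0 -> forall i, c i = 0).
  exists m.+1, g; split=> // x.
  by split=> [[a _ <-]|[a ->]]; exists a.
have [U Uunit [d cE]] := int_row_unimodular (\row_i c i).
have cdU i : c i = d * U ord0 i by move/rowP/(_ i): cE; rewrite !mxE.
have d_neq0 : d <> 0 by move=> d0; apply: ck; rewrite cdU d0 mul0r.
pose h i := Zcomb g (U i).
have h0 : h ord0 = 0.
  have : h ord0 *~ d = 0.
    rewrite -c_rel /h /Zcomb mulrz_suml; apply: eq_bigr => i _.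
    by rewrite cdU -mulrzA mulrC.
  by case/tf.
have [t [b bP]] := IHm (h \o lift ord0).
suff <- : Zspan (h \o lift ord0) = Zspan g by exists t, b.
apply/seteqP; split; apply: subgroup_Zspan; try exact: Zspan_subgroup.
  by move=> i; exists (U (lift ord0 i)).
move=> i; have [a _ <-] := mem_Zspan g i.
(* The coordinates on h are those on g times the inverse of U. *)
pose a' := (\row_j a j) *m invmx U.
exists (fun j => a' ord0 (lift ord0 j)) => //.
transitivity (Zcomb h (a' ord0)).
  by rewrite /Zcomb big_ord_recl h0 mul0rz add0r.
rewrite Zcomb_mulmx /a' mulmxKV //.
by rewrite /Zcomb; apply: eq_bigr => j _; rewrite mxE.
Qed.

Lemma finite_generated_subgroup (E : set V) :
  finite_set E -> exists m (g : 'I_m -> V),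
    generated_subgroup E = Zspan g.
Proof.
move=> /finite_seqP[s ->].
exists (size s), (fun i => s`_i); apply/seteqP; split.
  apply: smallest_sub; first exact: Zspan_subgroup.
  move=> x /= xs; move: (xs); rewrite -index_mem => ltxs.
  by have := mem_Zspan (fun i : 'I__ => s`_i) (Ordinal ltxs); rewrite /= nth_index.
move=> x xs G [Gsub sG]; apply: subgroup_Zspan xs => // i.
by apply: sG; exact: mem_nth.
Qed.

End ZSpan.

(** * Coordinates of the entries of products *)

Section BoundedEntries.
Variables (R : realType) (t : nat) (b : 'I_t -> R).

Definition bounded_entry (N : nat) : set (Rmax R) :=
  [set a | forall x, a = Some x ->
     exists2 c : 'I_t -> int, (forall i, `|c i| <= N)%N & x = Zcomb b c].

Lemma bounded_entry0 N : bounded_entry N 0.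
Proof. by []. Qed.

Lemma bounded_entry1 N : bounded_entry N 1.
Proof. by move=> _ [<-]; exists (fun=> 0); rewrite ?Zcomb0. Qed.

Lemma bounded_entryD N x y :
  bounded_entry N x -> bounded_entry N y -> bounded_entry N (x + y).
Proof.
case: x y => [x|] [y|] // Nx Ny _ [<-].
by case: (leP x y) => _; [exact: Ny | exact: Nx].
Qed.

Lemma bounded_entryM N M x y :
  bounded_entry N x -> bounded_entry M y -> bounded_entry (N + M) (x * y).
Proof.
case: x y => [x|] [y|] // /(_ _ erefl)[c cN ->] /(_ _ erefl)[d dM ->] _ [<-].
exists (fun i => c i + d i); last by rewrite ZcombD.
move=> i; apply: leq_trans (leq_add (cN i) (dM i)).
by rewrite -lez_nat PoszD !abszE ler_normD.
Qed.

Lemma bounded_entryW N M x :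
  (N <= M)%N -> bounded_entry N x -> bounded_entry M x.
Proof.
move=> NM Nx y xy; have [c cN yE] := Nx y xy.
by exists c => // i; exact: leq_trans NM.
Qed.

Definition bounded_UT n N : set 'M[Rmax R]_n :=
  UT R n `&` [set A | forall i j, bounded_entry N (A i j)].

Lemma bounded_UT1 n N : bounded_UT N (1 : 'M_n).
Proof.
split=> i j.
  by move=> ji; rewrite mxE -val_eqE /= gtn_eqF.
by rewrite mxE; case: eqP => _; [exact: bounded_entry1 | exact: bounded_entry0].
Qed.

Lemma bounded_UTM n N M (A B : 'M_n) :
  bounded_UT N A -> bounded_UT M B -> bounded_UT (N + M) (A * B).
Proof.
move=> [UA NA] [UB MB]; split=> i j.
  move=> ji; rewrite mxE big1 // => k _.
  have [ki|ik] := ltnP k i; first by rewrite UA // mul0r.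
  by rewrite UB ?mulr0 //; exact: leq_trans ik.
rewrite mxE; apply: (@big_ind _ (bounded_entry (N + M))) => // [x y|k _].
  exact: bounded_entryD.
exact: bounded_entryM.
Qed.

Lemma prod_entries_bounded n C i (w : 'I_i -> 'M[Rmax R]_n) :
  (forall j, bounded_UT C (w j)) -> bounded_UT (C * i) (\prod_(j < i) w j).
Proof.
elim: i w => [|i IHi] w Cw; first by rewrite big_ord0; exact: bounded_UT1.
by rewrite big_ord_recl mulnS; apply: bounded_UTM => //; exact: IHi.
Qed.

End BoundedEntries.

Lemma products_bounded_UT (R : realType) t (b : 'I_t -> R) n
    (X : set 'M[Rmax R]_n) C k :
  X `<=` bounded_UT b C ->
  \bigcup_(i in [set i | (1 <= i <= k)%N]) products X i
    `<=` bounded_UT b (C * k).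
Proof.
move=> XC A [i /= /andP[_ ik] [w /= Xw <-]].
have [UTw Nw] : bounded_UT b (C * i) (\prod_(j < i) w j).
  by apply: prod_entries_bounded => j; exact: XC.
split=> // p q; apply: bounded_entryW (Nw p q).
by rewrite leq_mul2l ik orbT.
Qed.

(** * Counting *)

Lemma card_upper_triangle n :
  #|{: {p : 'I_n * 'I_n | p.1 <= p.2}}|%N = ((n * n.+1) %/ 2)%N.
Proof.
rewrite card_sig -sum1_card.
rewrite -(pair_big_dep xpredT (fun i j : 'I_n => i <= j)%N (fun _ _ => 1%N)) /=.
rewrite (exchange_big_dep xpredT) //=.
transitivity (\sum_(j < n) j.+1)%N.
  apply: eq_bigr => j _.
  by rewrite -(big_ord_widen n (fun=> 1%N) (ltn_ord j)) sum1_card card_ord.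
have := triangular_sum n.+1; rewrite big_mkord big_ord_recl add0n => ->.
by rewrite bin2 /= mulnC divn2.
Qed.

Lemma card_fset_set_range (I : finType) (K : choiceType) (f : I -> K)
    (S : set K) : S `<=` range f -> (#|` fset_set S|%fset <= #|I|)%N.
Proof.
move=> Sf.
have Sfin : finite_set S by apply: sub_finite_set Sf _; exact: finite_image.
apply: (@leq_trans #|` [fset f i | i in I]%fset|).
  apply/fsubset_leq_card/fsubsetP => x.
  rewrite in_fset_set // inE => /Sf[i _ <-].
  by apply/imfsetP; exists i.
by rewrite cardE; exact: leq_imfset_card.
Qed.

(** The integers of absolute value at most N are the u - N for u <= 2N. *)
Definition shifted_Zcomb (R : realType) t (b : 'I_t -> R) N
    (u : {ffun 'I_t -> 'I_(N + N).+1}) : R :=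
  Zcomb b (fun i => (u i)%:Z - N%:Z).

Lemma bounded_entry_shifted (R : realType) t (b : 'I_t -> R) N a :
  bounded_entry b N a -> exists u, a = omap (@shifted_Zcomb R t b N) u.
Proof.
case: a => [x|] Na; last by exists None.
have [c cN ->] := Na x erefl.
have c_ge0 i : 0 <= c i + N%:Z.
  by rewrite -lerBlDr sub0r; apply: lerNnormlW; rewrite -abszE lez_nat.
have cNE i : c i = (absz (c i + N%:Z))%:Z - N%:Z.
  by rewrite gez0_abs // addrK.
exists (Some [ffun i => inord (absz (c i + N%:Z))]); congr Some.
rewrite /shifted_Zcomb /Zcomb; apply: eq_bigr => i _; congr (_ *~ _).
rewrite ffunE inordK // ltnS -lez_nat gez0_abs // PoszD lerD2r.
by apply: le_trans (ler_norm _) _; rewrite -abszE lez_nat.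
Qed.

Lemma card_bounded_matrices (R : realType) t (b : 'I_t -> R) n N
    (S : set 'M[Rmax R]_n) :
  S `<=` bounded_UT b N ->
  (#|` fset_set S|%fset <= ((N + N).+1 ^ t).+1 ^ ((n * n.+1) %/ 2))%N.
Proof.
move=> SN.
pose P := {p : 'I_n * 'I_n | p.1 <= p.2}%N.
pose U := option {ffun 'I_t -> 'I_(N + N).+1}.
pose mat (M : {ffun P -> U}) : 'M[Rmax R]_n :=
  \matrix_(i, j) if insub (i, j) is Some p
                 then omap (@shifted_Zcomb R t b N) (M p) else None.
have -> : (((N + N).+1 ^ t).+1 ^ ((n * n.+1) %/ 2))%N = #|{: {ffun P -> U}}|.
  by rewrite card_ffun card_option card_ffun !card_ord card_upper_triangle.
apply: (@card_fset_set_range _ _ mat) => A /SN[UTA NA].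
have /choice[M ME] (p : P) :
    exists u, A (val p).1 (val p).2 = omap (@shifted_Zcomb R t b N) u.
  exact: bounded_entry_shifted.
exists (finfun M) => //; apply/matrixP => i j; rewrite mxE.
case: insubP => [p _ pE|/=]; first by rewrite ffunE -ME pE.
by rewrite -ltnNge => /UTA.
Qed.

(** Once C and k are positive, 2Ck + 1 <= 3Ck and 1 <= (3Ck)^t. *)
Lemma counting_bound C k t m : (0 < C)%N -> (0 < k)%N ->
  (((C * k + C * k).+1 ^ t).+1 ^ m <= (2 * (3 * C) ^ t) ^ m * k ^ (t * m))%N.
Proof.
move=> C0 k0; rewrite expnM -expnMn -mulnA -expnMn.
have [->|m0] := posnP m; first by rewrite !expn0.
have Ck0 : (0 < C * k)%N by rewrite muln_gt0 C0.
rewrite leq_exp2r // mul2n -addnn -addn1 leq_add //; last first.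
  by rewrite expn_gt0 -mulnA muln_gt0 /= Ck0.
have [->|t0] := posnP t; first by rewrite !expn0.
by rewrite leq_exp2r // -mulnA !mulSn mul0n addn0 addnA -addn1 leq_add2l.
Qed.

(** * Entries of finitely generated semigroups *)

Lemma finite_finite_entries (R : realType) n (X : set 'M[Rmax R]_n) :
  finite_set X -> finite_set (finite_entries X).
Proof.
move=> Xfin.
pose entry (p : 'M[Rmax R]_n * ('I_n * 'I_n)) := odflt 0 (p.1 p.2.1 p.2.2).
apply: (@sub_finite_set _ _ (entry @` (X `*` setT))).
  by move=> x [A XA [i [j Aij]]]; exists (A, (i, j)); rewrite // /entry /= Aij.
by apply/finite_image/finite_setX => //; exact: finite_finset.
Qed.

(** A tropical sum is one of its terms, so a finite entry of A * B is the sum of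
    an entry of A and an entry of B. *)
Lemma subsemigroup_entries (R : realType) n (G : set R) :
  subgroup G -> subsemigroup [set A : 'M[Rmax R]_n | finite_entries [set A] `<=` G].
Proof.
move=> Gsub A B GA GB x [_ -> [i [j]]]; rewrite mxE => ABij.
pose K : set (Rmax R) := [set a | forall y, a = Some y -> G y].
suff KAB : K (\sum_k A i k * B k j) by exact: KAB ABij.
apply: (@big_ind _ K) => // [[y|] [z|] //= Ky Kz _ [<-]|k _].
  by case: (leP y z) => _; [exact: Kz | exact: Ky].
rewrite /K /=; case Aik: (A i k) => [y|] //; case Bkj: (B k j) => [z|] // _ [<-].
apply: subgroupD => //.
  by apply: GA; exists A => //; exists i, k.
by apply: GB; exists B => //; exists k, j.
Qed.

Lemma generated_subgroup_finite_entries (R : realType) n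
    (X : set 'M[Rmax R]_n) :
  generated_subgroup (finite_entries (generated_semigroup X)) =
  generated_subgroup (finite_entries X).
Proof.
set G := RHS.
have Gsub : subgroup G.
  split=> [H [[H0 _] _]|x y Gx Gy H HP] //.
  by case: (HP) => -[_ HB] _; apply: HB; [exact: Gx | exact: Gy].
have XG : finite_entries X `<=` G by exact: sub_gen_smallest.
apply/seteqP; split.
  apply: smallest_sub => // x [A TA [i [j Aij]]].
  suff : finite_entries [set A] `<=` G by apply; exists A => //; exists i, j.
  apply: (TA [set B | finite_entries [set B] `<=` G]).
    split; first exact: subsemigroup_entries.
    move=> B XB y [_ -> [k [l Bkl]]].
    by apply: XG; exists B => //; exists k, l.
move=> x Gx H [Hsub TH]; apply: Gx; split=> // y [A XA Ay].
by apply: TH; exists A => //; exact: sub_gen_smallest.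
Qed.

Lemma finite_subset_bounded_entry (R : realType) t (b : 'I_t -> R) (E : set R) :
  finite_set E -> E `<=` Zspan b ->
  exists2 C, (0 < C)%N & forall x, E x -> bounded_entry b C (Some x).
Proof.
move=> /finite_seqP[s ->] sb.
have /choice[c cP] x : exists c : 'I_t -> int, x \in s -> x = Zcomb b c.
  have [/sb[c _ <-]|xNs] := pselect (x \in s); first by exists c.
  by exists (fun=> 0).
exists (\max_(x <- s) \max_i `|c x i|).+1%N => // x xs _ [<-].
exists (c x) => [i|]; last exact: cP.
apply: leqW; apply: (@leq_trans (\max_i `|c x i|)%N).
  exact: (@leq_bigmax _ (fun i => absz (c x i))).
exact: (@leq_bigmax_seq _ _ _ (fun x => \max_i `|c x i|)%N).
Qed.

Theorem corollary6p6 (R : realType) (n : nat) (n_gt0 : (0 < n)%N)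
    (T : set 'M[Rmax R]_n)
    (T_UT : T `<=` UT R n)
    (T_sub : subsemigroup T)
    (T_fg : fin_gen_semigroup T)
    (t : nat)
    (tE : t = free_rank (generated_subgroup (finite_entries T))) :
  growth_bounded_by_degree R T ((t * n * (n + 1)) %/ 2)%N.
Proof.
move=> X Xfin TX.
have Efin := finite_finite_entries Xfin.
move: tE; rewrite TX generated_subgroup_finite_entries.
have [m [g genE]] := finite_generated_subgroup Efin.
have [|t' [b bP]] := Zspan_has_basis g.
  move=> x d /eqP; rewrite mulrz_eq0 => /orP[]/eqP; first by left.
  by right.
rewrite genE (free_rankE bP) => tt'; subst t'.
have bG : finite_entries X `<=` Zspan b.
  move=> x /(@sub_gen_smallest _ (@subgroup R)); rewrite -/(generated_subgroup _).
  by rewrite genE => /bP.1[c ->]; exists c.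
have [C C0 XC] := finite_subset_bounded_entry Efin bG.
have XCU : X `<=` bounded_UT b C.
  move=> A XA; split.
    by apply: T_UT; rewrite TX; exact: sub_gen_smallest.
  move=> i j x Aij; apply: XC => //.
  by exists A => //; exists i, j.
pose d := ((n * n.+1) %/ 2)%N.
have -> : ((t * n * (n + 1)) %/ 2 = t * d)%N.
  rewrite addn1 -mulnA /d muln_divA // dvdn2 oddM /=.
  by case: (odd n).
exists ((2 * (3 * C) ^ t) ^ d)%:R.
  by rewrite ltr0n expn_gt0 muln_gt0 /= expn_gt0 muln_gt0 /= C0.
move=> k k0; rewrite -natrX -natrM ler_nat.
apply: leq_trans (counting_bound _ _ C0 k0).
exact: (card_bounded_matrices (products_bounded_UT XCU)).
Qed.
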